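(* Let $R$ be a commutative ring with identity, $S\subseteq R$ a multiplicative set, and $J$ an ideal of $R$. If $R$ is an $S$-$J$-Noetherian ring, then $R/J$ is an $\overline{S}$-Noetherian ring, where $\overline{S}=\{s+J\mid s\in S\}\subseteq R/J$.
   Context: A multiplicative set is a subset containing $1$ and closed under multiplication. For a commutative ring $A$ and a multiplicative set $T\subseteq A$, an ideal $I$ of $A$ is $T$-finite if there exist $t\in T$ and a finitely generated ideal $F$ of $A$ such that $tI\subseteq F\subseteq I$; $A$ is $T$-Noetherian if every ideal of $A$ is $T$-finite. An ideal $I$ of $R$ is called a $J$-ideal if $I\nsubseteq J$. The ring $R$ is called $S$-$J$-Noetherian if every $J$-ideal of $R$ is $S$-finite. *)

(* Defs.v *)
From HB Require Import structures.
From mathcomp Require Import all_boot all_algebra.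
From mathcomp Require Import boolp classical_sets functions cardinality.

Set Implicit Arguments.
Unset Strict Implicit.
Unset Printing Implicit Defensive.

Import GRing.Theory.
Local Open Scope ring_scope.
Local Open Scope quotient_scope.
Local Open Scope classical_set_scope.

Definition is_ideal (A : comPzRingType) (I : set A) : Prop :=
  [/\ I 0, (forall x y, I x -> I y -> I (x + y))
    & (forall a x, I x -> I (a * x))].

(* The [idealr] structure of MathComp only covers proper ideals of nontrivial
   rings; here the zero ring and the unit ideal are allowed. *)
Record ideal (A : comPzRingType) := Ideal {
  ideal_set :> set A;
  idealP : is_ideal ideal_set
}.

Definition multiplicative_set (A : comPzRingType) (T : set A) : Prop :=
  T 1 /\ (forall x y, T x -> T y -> T (x * y)).

Definition finitely_generated (A : comPzRingType) (F : ideal A) : Prop :=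
  exists X : set A, finite_set X /\ F = smallest (@is_ideal A) X :> set A.

Definition T_finite (A : comPzRingType) (T : set A) (I : ideal A) : Prop :=
  exists (t : A) (F : ideal A),
    [/\ T t, finitely_generated F, [set t * x | x in I] `<=` F & F `<=` I].

Definition T_noetherian (A : comPzRingType) (T : set A) : Prop :=
  forall I : ideal A, T_finite T I.

Definition J_ideal (R : comPzRingType) (J I : ideal R) : Prop :=
  ~ (I `<=` J).

Definition S_J_noetherian (R : comPzRingType) (S : set R) (J : ideal R) :
    Prop :=
  forall I : ideal R, J_ideal J I -> T_finite S I.

(* [Quotient.quot] is an abelian group for every additive subgroup, but
   MathComp makes it a ring only modulo a proper ideal; the ring structure is
   rebuilt below for an arbitrary ideal, with J = R giving the zero ring. *)
Section QuotientRing.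
Variables (R : comPzRingType) (J : ideal R).

Definition ideal_pred : R -> bool := fun x => `[< ideal_set J x >].

Lemma ideal_pred_zmod_closed : zmod_closed ideal_pred.
Proof.
have [J0 JD JM] := idealP J.
split=> [|x y /asboolP Jx /asboolP Jy]; apply/asboolP => //.
by apply: JD => //; rewrite -mulN1r; apply: JM.
Qed.

HB.instance Definition _ :=
  GRing.isZmodClosed.Build R ideal_pred ideal_pred_zmod_closed.

Definition ideal_zmod : zmodClosed R := GRing.ZmodClosed.clone R ideal_pred _.

Definition quotient_ring := Quotient.quot ideal_zmod.

HB.instance Definition _ := ZmodQuotient.on quotient_ring.

Lemma quotient_piP (x y : R) :
  \pi_quotient_ring x = \pi_quotient_ring y <-> ideal_set J (x - y).
Proof.
by split=> [/eqP|h]; last apply/eqP; rewrite -Quotient.idealrBE;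
  [move/asboolP | apply/asboolP].
Qed.

Definition quotient_one : quotient_ring := \pi_quotient_ring 1.
Definition quotient_mul := lift_op2 quotient_ring *%R.

Lemma quotient_pi_mul :
  {morph \pi_quotient_ring : x y / x * y >-> quotient_mul x y}.
Proof.
move=> x y; unlock quotient_mul; apply/quotient_piP; have [_ JD JM] := idealP J.
set x' := repr _; set y' := repr _.
have Jx : ideal_set J (x - x') by apply/quotient_piP; rewrite reprK.
have Jy : ideal_set J (y - y') by apply/quotient_piP; rewrite reprK.
have -> : x * y - x' * y' = y * (x - x') + x' * (y - y').
  by rewrite !mulrBr (mulrC y x) (mulrC y x') addrA addrNK.
by apply: JD; apply: JM.
Qed.

Lemma quotient_mulA : associative quotient_mul.
Proof.
by move=> x y z; rewrite -[x]reprK -[y]reprK -[z]reprK -!quotient_pi_mul mulrA.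
Qed.

Lemma quotient_mulC : commutative quotient_mul.
Proof.
by move=> x y; rewrite -[x]reprK -[y]reprK -!quotient_pi_mul mulrC.
Qed.

Lemma quotient_mul1 : left_id quotient_one quotient_mul.
Proof. by move=> x; rewrite -[x]reprK -quotient_pi_mul mul1r. Qed.

Lemma quotient_mulDl : left_distributive quotient_mul +%R.
Proof.
move=> x y z; rewrite -[x]reprK -[y]reprK -[z]reprK.
rewrite -!(raddfD \pi_quotient_ring) -!quotient_pi_mul.
by rewrite -!(raddfD \pi_quotient_ring) mulrDl.
Qed.

HB.instance Definition _ := GRing.Zmodule_isComPzRing.Build quotient_ring
  quotient_mulA quotient_mulC quotient_mul1 quotient_mulDl.

Definition quotient_map : R -> quotient_ring := \pi_quotient_ring.

Lemma quotient_map_zmod_morphism : zmod_morphism quotient_map.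
Proof. by move=> x y; rewrite /quotient_map raddfB. Qed.

Lemma quotient_map_monoid_morphism : monoid_morphism quotient_map.
Proof. by split=> // x y; rewrite /quotient_map quotient_pi_mul. Qed.

HB.instance Definition _ :=
  GRing.isZmodMorphism.Build R quotient_ring quotient_map
    quotient_map_zmod_morphism.
HB.instance Definition _ :=
  GRing.isMonoidMorphism.Build R quotient_ring quotient_map
    quotient_map_monoid_morphism.

Lemma quotient_map_surj (u : quotient_ring) : exists x, quotient_map x = u.
Proof. by exists (repr u); rewrite /quotient_map reprK. Qed.

Definition quotient_set (S : set R) : set quotient_ring :=
  [set quotient_map s | s in S].

Lemma quotient_set_multiplicative (S : set R) :
  multiplicative_set S -> multiplicative_set (quotient_set S).
Proof.
move=> [S1 SM]; split; first by exists 1 => //; rewrite rmorph1.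
move=> _ _ [x Sx <-] [y Sy <-]; exists (x * y); first exact: SM.
by rewrite rmorphM.
Qed.

End QuotientRing.

Arguments quotient_map {R} J _ : simpl never.
Arguments quotient_set {R} J S _.
Arguments quotient_map_surj {R J} u.
Arguments quotient_set_multiplicative {R} J {S}.

(* Main.v *)
Require Import Defs.
From mathcomp Require Import all_boot all_algebra.
From mathcomp Require Import classical_sets.
From mathcomp Require Import boolp cardinality.

(** Pull an ideal [K] of [R/J] back to the ideal [I] of [R] along the
    projection, so that [K] is the image of [I].  If [I] is not contained in
    [J], then [I] is a [J]-ideal, hence [S]-finite, and [S]-finiteness passes
    to images under surjective ring morphisms ([T_finite_image]): from
    [s I <= F <= I] one gets [f(s) K <= f(F) <= K], where [f(F)] is an ideal
    because [f] is surjective, and is generated by the images of the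
    generators of [F] ([image_generated_ideal]).  If [I] is contained in [J],
    then [K] vanishes and there is nothing to choose: [K] is generated by the
    empty set, and [1] is a witness. *)

Set Implicit Arguments.
Unset Strict Implicit.
Unset Printing Implicit Defensive.

Import GRing.Theory.
Local Open Scope ring_scope.
Local Open Scope classical_set_scope.

Lemma is_ideal_generated (A : comPzRingType) (X : set A) :
  is_ideal (smallest (@is_ideal A) X).
Proof.
split=> [M [[M0 _ _] _] //|x y Xx Xy M MX|a x Xx M MX].
- by have [[_ MD _] _] := MX; apply: MD; [apply: Xx|apply: Xy].
- by have [[_ _ MM] _] := MX; apply: MM; apply: Xx.
Qed.

Section IdealTransport.
Variables (A B : comPzRingType) (f : {rmorphism A -> B}).

Lemma is_ideal_preimage (M : set B) : is_ideal M -> is_ideal (f @^-1` M).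
Proof.
move=> [M0 MD MM]; split=> [|x y Mx My|a x Mx] /=.
- by rewrite rmorph0.
- by rewrite rmorphD; apply: MD.
- by rewrite rmorphM; apply: MM.
Qed.

Hypothesis f_surj : forall b, exists a, f a = b.

Lemma is_ideal_image (I : set A) : is_ideal I -> is_ideal (f @` I).
Proof.
move=> [I0 ID IM]; split.
- by exists 0 => //; rewrite rmorph0.
- by move=> _ _ [x Ix <-] [y Iy <-]; exists (x + y); [apply: ID|rewrite rmorphD].
- move=> b _ [x Ix <-]; have [a <-] := f_surj b.
  by exists (a * x); [apply: IM|rewrite rmorphM].
Qed.

(** Both inclusions come from minimality of a generated ideal: the image of
    [(X)] is an ideal containing [f(X)], and the preimage of an ideal
    containing [f(X)] is an ideal containing [X]. *)
Lemma image_generated_ideal (X : set A) :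
  f @` smallest (@is_ideal A) X = smallest (@is_ideal B) (f @` X).
Proof.
apply/seteqP; split=> [_ [x Xx <-] M [idM XM]|].
  apply: (Xx (f @^-1` M)); split; first exact: is_ideal_preimage.
  by move=> z Xz; apply: XM; exists z.
apply: smallest_sub; first exact/is_ideal_image/is_ideal_generated.
by apply: image_subset; apply: sub_gen_smallest.
Qed.

Lemma T_finite_image (T : set A) (I : ideal A) (K : ideal B) :
  f @` I = K :> set B -> T_finite T I -> T_finite (f @` T) K.
Proof.
move=> fIK [t [F [Tt [X [finX FX]] tIF FI]]].
exists (f t), (Ideal (is_ideal_image (idealP F))); split=> /=.
- by exists t.
- exists (f @` X); split; first exact: finite_image.
  by rewrite /= FX image_generated_ideal.
- rewrite -fIK => _ [_ [x Ix <-] <-]; exists (t * x); last by rewrite rmorphM.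
  by apply: tIF; exists x.
- by rewrite -fIK; apply: image_subset.
Qed.

End IdealTransport.

Lemma T_finite_zero (A : comPzRingType) (T : set A) (K : ideal A) :
  T 1 -> K `<=` [set 0] -> T_finite T K.
Proof.
move=> T1 K0; exists 1, K; split=> //.
- exists set0; split; first exact: finite_set0.
  apply/seteqP; split=> [x /K0 -> M [[M0 _ _] _] //|].
  by apply: smallest_sub; [apply: idealP|apply: sub0set].
- by move=> _ [x Kx <-]; rewrite mul1r.
Qed.

Theorem proposition2p11 (R : comPzRingType) (S : set R) (J : ideal R)
    (hS : multiplicative_set S) (hR : S_J_noetherian S J) :
  T_noetherian (quotient_set J S).
Proof.
move=> K.
pose I := Ideal (is_ideal_preimage (quotient_map J) (idealP K)).
have [IJ|nIJ] := pselect (I `<=` J); last first.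
  apply: (@T_finite_image _ _ (quotient_map J) quotient_map_surj S I K).
    by apply: image_preimage; apply/seteqP; split=> // b _;
      have [a <-] := quotient_map_surj b; exists a.
  exact: hR.
apply: T_finite_zero; first by have [] := quotient_set_multiplicative J hS.
move=> u Ku; have [x xu] := quotient_map_surj u; rewrite -xu in Ku *.
have Jx : ideal_set J x by apply: IJ.
rewrite /= -(rmorph0 (quotient_map J)).
by apply/quotient_piP; rewrite subr0.
Qed.
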